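(* Consider the (static) lowest unique bid auction game with exactly two bidders, $n=2$. In every (possibly mixed, possibly asymmetric) Nash equilibrium $(\sigma_1,\sigma_2)$ of this game, both $\sigma_1$ and $\sigma_2$ are monotone strategies.
   Context: The lowest unique bid auction game: there is an object of common value $v>0$ (a real number), a bidding cost $c>0$ (a real number), and a set of bidders $\mathcal{B}=\{1,\dots,n\}$. Here $\mathbb{N}$ denotes the positive integers. Simultaneously and independently, each bidder $i$ submits a finite (possibly empty) set $S_i\subset\mathbb{N}$ of bids. Let $S_*=\{s\in\mathbb{N}: \#\{i\in\mathcal{B}: s\in S_i\}=1\}$ be the set of integers bid by exactly one bidder. If $S_*=\varnothing$ there is no winner. If $S_*\neq\varnothing$, the winning bid is $s_*=\min(S_* )$ and the winner $i_*$ is the unique bidder with $s_*\in S_{i_*}$. The payoff of bidder $i$ is $u_i(S_1,\dots,S_n)=-c|S_i|+v-s_*$ if $i$ is the winner, and $u_i(S_1,\dots,S_n)=-c|S_i|$ otherwise. A pure strategy is a finite subset of $\mathbb{N}$; a mixed strategy $\sigma$ is a probability distribution over pure strategies, $\sigma(S)$ being the probability of the set $S$. Bidders maximize expected payoff, and ''equilibrium'' means Nash equilibrium in mixed strategies. A mixed strategy is monotone if every set in its support is of the form $\{1,2,\dots,k\}$ for some integer $k\ge 0$ (where $k=0$ gives the empty set, i.e. not participating). *)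

(* Defs.v *)
From HB Require Import structures.
From mathcomp Require Import all_boot all_order all_algebra.
From mathcomp Require Import finmap.
From mathcomp Require Import all_classical all_reals all_analysis.
Set Implicit Arguments.
Unset Strict Implicit.
Unset Printing Implicit Defensive.
Import Order.TTheory GRing.Theory Num.Theory.
Local Open Scope ring_scope.

Notation bid := {s : nat | (0 < s)%N}.

Notation strategy := {fset bid}.

(* Bidders are indexed from 0. *)
Notation profile n := {ffun 'I_n -> strategy}.

Definition unique_bids (n : nat) (S : profile n) : {fset bid} :=
  [fset s in (\big[fsetU/fset0]_(i < n) S i)%fset
    | #|[set i : 'I_n | s \in S i]%SET| == 1%N]%fset.

(* The minimum of [unique_bids S], or [None] when that set is empty. *)
Definition winning_bid (n : nat) (S : profile n) : option bid :=
  ohead (sort (fun s t : bid => (val s <= val t)%N) (enum_fset (unique_bids S))).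

(* Since the winning bid is submitted by exactly one bidder, bidder i is the
   winner iff it belongs to [S i]. *)
Definition payoff (R : realType) (n : nat) (v c : R) (S : profile n)
    (i : 'I_n) : R :=
  - (c * (#|` S i|)%:R) +
  (if winning_bid S is Some s then
     if s \in S i then v - (val s)%:R else 0
   else 0).

Record mixed_strategy (R : realType) := MixedStrategy {
  prob :> strategy -> R ;
  prob_ge0 : forall S, 0 <= prob S ;
  prob_sum1 : \esum_(S in [set: strategy]) (prob S)%:E = 1%E }.

(* Bidders randomize independently.  Payoffs are at most v when c >= 0, so the
   sum of the positive parts is then finite and the difference below is never
   of the form +oo - +oo; it may be -oo. *)
Definition expected_payoff (R : realType) (n : nat) (v c : R)
    (sigma : 'I_n -> mixed_strategy R) (i : 'I_n) : \bar R :=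
  let f := fun S : profile n =>
    ((\prod_(j < n) sigma j (S j)) * payoff v c S i)%:E in
  (\esum_(S in [set: profile n]) (f^\+)%E S
   - \esum_(S in [set: profile n]) (f^\-)%E S)%E.

Definition nash_equilibrium (R : realType) (n : nat) (v c : R)
    (sigma : 'I_n -> mixed_strategy R) : Prop :=
  forall (i : 'I_n) (tau : mixed_strategy R),
    (expected_payoff v c [eta sigma with i |-> tau] i
     <= expected_payoff v c sigma i)%E.

Definition monotone_strategy (R : realType) (sigma : mixed_strategy R) : Prop :=
  forall S : strategy, 0 < sigma S ->
    exists k : nat, forall s : bid, (s \in S) = (val s <= k)%N.

(* Main.v *)
(* Let [S] be a set of bids whose first gap is [m], with a bid above [m].  A bid
   above [m] can only help [S] against opponents that bid on all of [{1..m-1}]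
   but not on [m]; there [{1..m}] wins at the lower price [m], and against all
   other opponents [{1..m-1}] does as well as [S] at a lower cost.  Hence some
   mixture of [{1..m-1}] and [{1..m}] strictly dominates [S] (if [v <= m], then
   [{1..m-1}] does so by itself), and [S] is not a best response to any mixed
   strategy. *)
Require Import Defs.
From mathcomp Require Import all_boot all_order all_algebra.
From mathcomp Require Import finmap.
From mathcomp Require Import all_classical all_reals all_analysis.
From mathcomp Require Import lra ring.
Set Implicit Arguments.
Unset Strict Implicit.
Unset Printing Implicit Defensive.
Import Order.TTheory GRing.Theory Num.Theory.
Local Open Scope ring_scope.

(** * The winning bid and profiles of two bidders *)

Lemma winning_bidP (n : nat) (S : profile n) :
  if winning_bid S is Some s then
    s \in unique_bids S /\ forall t, t \in unique_bids S -> (val s <= val t)%N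
  else unique_bids S = fset0.
Proof.
rewrite /winning_bid; set leb := fun s t : bid => (val s <= val t)%N.
set r := enum_fset (unique_bids S).
have leb_total : total leb by move=> s t; exact: leq_total.
have leb_trans : transitive leb by move=> s t u; exact: leq_trans.
have := sort_sorted leb_total r; have := mem_sort leb r.
case: (sort leb r) => [|s r'] mem_r /=.
  by move=> _; apply/fsetP => t; rewrite inE -[LHS]mem_r.
rewrite path_sortedE// => /andP[/allP s_min _]; split.
  by rewrite -[_ \in _]mem_r mem_head.
move=> t; rewrite -[_ \in _]mem_r in_cons => /predU1P[->//|].
exact: s_min.
Qed.

Definition two_profile (i : 'I_2) (S T : strategy) : profile 2 :=
  [ffun k => if k == i then S else T].

(** The opponent of [i] is [lift i ord0], the only other index in ['I_2]; keeping [i] arbitrary lets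
    one argument serve both bidders. *)
Lemma two_profileE (i : 'I_2) (P : profile 2) :
  two_profile i (P i) (P (lift i ord0)) = P.
Proof.
apply/ffunP => k; rewrite ffunE; case: eqVneq => [->//|ki].
congr (P _); apply/val_inj; move: ki.
by case: i k => [[|[|//]] ?] [[|[|//]] ?].
Qed.

Lemma in_unique_bids2 (i : 'I_2) (S T : strategy) (s : bid) :
  (s \in unique_bids (two_profile i S T)) = ((s \in S) != (s \in T)).
Proof.
rewrite !inE /=.
have -> : #|[set k | s \in two_profile i S T k]%SET| =
    ((s \in S) + (s \in T))%N.
  rewrite -sum1_card big_mkcond /= !big_ord_recl big_ord0 !inE !ffunE.
  case: i => [[|[|//]] p]; rewrite -!(inj_eq val_inj) /=;
    by case: (s \in S); case: (s \in T).
rewrite !big_ord_recl big_ord0 !inE !ffunE.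
case: i => [[|[|//]] p]; rewrite -!(inj_eq val_inj) /=;
  by case: (s \in S); case: (s \in T).
Qed.

(** * Winnings before bidding costs *)

Section gross.
Variables (R : realType) (v : R).

Definition gross (S T : strategy) (i : 'I_2) : R :=
  if winning_bid (two_profile i S T) is Some s then
    if s \in S then v - (val s)%:R else 0
  else 0.

Lemma payoff2E (c : R) (i : 'I_2) (S T : strategy) :
  payoff v c (two_profile i S T) i = gross S T i - c * (#|` S|)%:R.
Proof. by rewrite /payoff ffunE eqxx addrC. Qed.

(** With two bidders the unique bids form the symmetric difference of [S] and [T], so the winning
    bid is the least bid on which the two sets disagree. *)
Lemma gross_cases (S T : strategy) (i : 'I_2) :
  gross S T i = 0 \/
  exists2 s : bid, (s \in S) && (s \notin T) & gross S T i = v - (val s)%:R /\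
    forall t : bid, (val t < val s)%N -> (t \in S) = (t \in T).
Proof.
rewrite /gross; have := winning_bidP (two_profile i S T).
case: winning_bid => [s [sU s_min]|]; last by left.
case: ifP => sS; last by left.
right; exists s; first by move: sU; rewrite in_unique_bids2 sS; case: (s \in T).
split=> // t ts; apply/eqP/negPn; rewrite -(in_unique_bids2 i).
by apply: contraL ts => /s_min; rewrite -leqNgt.
Qed.

Lemma gross_win (S T : strategy) (i : 'I_2) (s : bid) :
    s \in S -> s \notin T ->
    (forall t : bid, (val t < val s)%N -> (t \in S) = (t \in T)) ->
  gross S T i = v - (val s)%:R.
Proof.
move=> sS sT agree; rewrite /gross; have := winning_bidP (two_profile i S T).
have sU : s \in unique_bids (two_profile i S T).
  by rewrite in_unique_bids2 sS (negbTE sT).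
case: winning_bid => [t [tU t_min]|U0]; last by rewrite U0 in sU.
suff -> : t = s by rewrite sS.
apply/val_inj/eqP; rewrite eqn_leq t_min//= leqNgt.
by apply: contraL tU => /agree; rewrite in_unique_bids2 => ->; rewrite eqxx.
Qed.

Lemma gross_subset (S T : strategy) (i : 'I_2) :
  {subset S <= T} -> gross S T i = 0.
Proof. by move=> ST; case: (gross_cases S T i) => // -[s /andP[/ST->]]. Qed.

Lemma gross_le (S T : strategy) (i : 'I_2) : 0 <= v -> gross S T i <= v.
Proof.
move=> v0; case: (gross_cases S T i) => [->//|[s _ [-> _]]].
by rewrite lerBlDr lerDl.
Qed.

End gross.

(** * Strict dominance of sets with a gap *)

Section first_gap.
Variables (S : strategy) (m a : bid).
Hypotheses (below : forall t : bid, (val t < val m)%N -> t \in S).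
Hypotheses (mS : m \notin S) (aS : a \in S) (ma : (val m < val a)%N).

Let lower : strategy := [fset s in S | (val s < val m)%N]%fset.
Let upper : strategy := (m |` lower)%fset.

Let in_lower t : (t \in lower) = (val t < val m)%N.
Proof.
rewrite !inE /= -[LHS]/((t \in S) && (val t < val m)%N).
by apply/andb_idl => /below.
Qed.

Let in_upper t : (t \in upper) = (val t <= val m)%N.
Proof. by rewrite in_fset1U in_lower [RHS]leq_eqVlt (inj_eq val_inj). Qed.

Let card_upper : #|` upper| = #|` lower|.+1.
Proof. by rewrite cardfsU1 in_lower ltnn. Qed.

Let card_lower : (#|` lower| < #|` S|)%N.
Proof.
apply: fproper_ltn_card; rewrite fproperE; apply/andP; split.
  by apply/fsubsetP => t; rewrite in_lower => /below.
by apply/fsubsetPn; exists a => //; rewrite in_lower -leqNgt ltnW.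
Qed.

(** The weights [x] and [y] are left unnormalized to avoid division. The margin [e] does not depend
    on [T], so it survives averaging over the opponent's sets. *)
Lemma gap_dominated (R : realType) (v c : R) (i : 'I_2) : 0 < v -> 0 < c ->
  exists x y e : R, exists M N : strategy, [/\ 0 <= x, 0 <= y, 0 < e &
    forall T, (x + y) * payoff v c (two_profile i S T) i + e <=
      x * payoff v c (two_profile i M T) i +
      y * payoff v c (two_profile i N T) i].
Proof.
move=> v0 c0.
have cost_lower : c * (#|` lower|)%:R + c <= c * (#|` S|)%:R.
  by rewrite -{2}(mulr1 c) -mulrDr natr1 ler_pM2l// ler_nat.
have cost_upper : c * (#|` upper|)%:R <= c * (#|` S|)%:R.
  by rewrite ler_pM2l// ler_nat card_upper.
(* The second alternative is the case where [T] contains every bid below [m] but not [m]. Otherwise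
   the first disagreement with [T] is either a common win below [m], or [m] itself, bid by [T] and
   then fatal to [S]. *)
have key T :
    (gross v S T i = gross v lower T i /\ gross v S T i <= gross v upper T i) \/
    [/\ gross v lower T i = 0, gross v upper T i = v - (val m)%:R &
        gross v S T i <= 0 \/ gross v S T i <= v - (val m)%:R - 1].
  have [[b /andP[bm bT]]|noB] :=
      pselect (exists b : bid, (val b < val m)%N && (b \notin T)).
    (* The least bid [d] missing from [T] lies below [m], hence in all three sets, and each of them
       wins with it. *)
    have exb : exists k, `[< exists2 t : bid, val t = k & t \notin T >].
      by exists (val b); apply/asboolP; exists b.
    case: (ex_minnP exb) => k /asboolP[d dE dT] k_min; left.
    have inT t : (val t < val d)%N -> t \in T.
      move=> td; apply/negPn/negP => tT.
      suff: (val d <= val t)%N by rewrite leqNgt td.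
      by rewrite dE; apply: k_min; apply/asboolP; exists t.
    have dm : (val d < val m)%N.
      apply: leq_ltn_trans bm; rewrite dE; apply: k_min.
      by apply/asboolP; exists b.
    have gain X : d \in X -> (forall t : bid, (val t < val d)%N -> t \in X) ->
        gross v X T i = v - (val d)%:R.
      by move=> dX inX; apply: gross_win => // t td; rewrite inT ?inX.
    rewrite !gain ?in_lower ?in_upper ?below ?(ltnW dm)// => t td.
    - by rewrite in_upper ltnW// (ltn_trans td).
    - by rewrite in_lower (ltn_trans td).
    - by rewrite below// (ltn_trans td).
  have inT t : (val t < val m)%N -> t \in T.
    by move=> tm; apply/negPn/negP => tT; apply: noB; exists t; rewrite tm.
  have lower0 : gross v lower T i = 0.
    by apply: gross_subset => t; rewrite in_lower => /inT.
  have [mT|mT] := boolP (m \in T).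
    left; rewrite lower0 [gross v upper T i]gross_subset; last first.
      move=> t; rewrite in_upper leq_eqVlt => /orP[/eqP/val_inj->//|].
      exact: inT.
    case: (gross_cases v S T i) => [->//|[s /andP[sS sT] [_ agree]]].
    have : (val m < val s)%N.
      rewrite ltn_neqAle; apply/andP; split.
        by apply: contraNneq mS => /val_inj->.
      by rewrite leqNgt; apply: contra sT => /inT.
    by move/agree; rewrite mT (negbTE mS).
  right; split=> //.
    apply: gross_win; rewrite ?in_upper// => t tm.
    by rewrite in_upper inT// ltnW.
  case: (gross_cases v S T i) => [->|[s /andP[sS sT] [-> _]]]; first by left.
  right; rewrite -addrA -opprD lerD2l lerN2 natr1 ler_nat.
  rewrite ltn_neqAle; apply/andP; split.
    by apply: contraNneq mS => /val_inj->.
  by rewrite leqNgt; apply: contra sT => /inT.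
(* If [v <= m], a win above [m] is worth less than nothing, so [lower] alone dominates, by the cost
   [c] of at least one saved bid. *)
have [vm|mv] := leP v (val m)%:R.
  exists 0, 1, c, upper, lower; split=> // T; rewrite !payoff2E.
  rewrite add0r !mul1r mul0r add0r.
  by case: (key T) => [[-> _]|[-> _ []]]; lra.
(* In the critical case [upper] earns at least [y] more than [S]: the gain is [v - m] if [S] earns
   at most 0, and at least 1 if [S] wins above [m]. Weighted by [v], this offsets the at most [v]
   that [lower] gives up with weight [y]; the cost saved by [lower] leaves the margin [y * c]. *)
pose y : R := Num.min 1 (v - (val m)%:R).
have y0 : 0 < y by rewrite lt_min ltr01 subr_gt0.
have y1 : y <= 1 by rewrite ge_min lexx.
have yv : y <= v - (val m)%:R by rewrite ge_min lexx orbT.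
exists v, y, (y * c), upper, lower; split; rewrite ?ltW ?mulr_gt0// => T.
rewrite !payoff2E.
set cS := c * (#|` S|)%:R in cost_lower cost_upper *.
set cl := c * (#|` lower|)%:R in cost_lower *.
set cu := c * (#|` upper|)%:R in cost_upper *.
have costs : 0 <= y * (cS - cl - c) by rewrite mulr_ge0 ?(ltW y0)//; lra.
have := gross_le S T i (ltW v0); case: (key T) => [[<- gu]|[-> -> gS]] gv.
  have : 0 <= v * (gross v upper T i - cu - gross v S T i + cS).
    by rewrite mulr_ge0 ?(ltW v0)//; lra.
  by lra.
have : 0 <= v * (v - (val m)%:R - y - gross v S T i - cu + cS).
  by rewrite mulr_ge0 ?(ltW v0)//; case: gS; lra.
have : 0 <= y * (v - gross v S T i) by rewrite mulr_ge0 ?(ltW y0)//; lra.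
by lra.
Qed.

End first_gap.

(** Take for [m] the least bid missing from [S]; if no bid of [S] exceeded it, [S] would be an
    initial segment. *)
Lemma first_gap_exists (S : strategy) :
    ~ (exists k : nat, forall s : bid, (s \in S) = (val s <= k)%N) ->
  exists m a : bid, [/\ forall t : bid, (val t < val m)%N -> t \in S,
    m \notin S, a \in S & (val m < val a)%N].
Proof.
move=> nmono; pose bidS k : bid := exist _ k.+1 isT.
have exk : exists k, bidS k \notin S.
  (* Since [bidS k] has value [k.+1], this is the bid just above the maximum of [S]. *)
  exists (\max_(s <- S) val s)%N; apply/negP => bidS_in.
  have := @leq_bigmax_seq _ (enum_fset S) xpredT (fun s : bid => val s) _
    bidS_in isT.
  by rewrite ltnn.
case: (ex_minnP exk) => k kS k_min.
have below (t : bid) : (val t < k.+1)%N -> t \in S.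
  case: t => [[//|t] t0] /= tk; apply/negPn/negP => tS.
  suff : (k <= t)%N by rewrite leqNgt -ltnS tk.
  by apply: k_min; apply: contra tS; congr (_ \in S); exact: val_inj.
exists (bidS k).
apply: contrapT => noa; apply: nmono; exists k => s.
apply/idP/idP => [sS|]; last exact: below.
rewrite leqNgt; apply/negP => ks; apply: noa; exists s; split=> //.
rewrite ltn_neqAle ks andbT; apply: contraNneq kS => ksE.
by rewrite (_ : bidS k = s)//; exact: val_inj.
Qed.

(** * Scaling and iterating nonnegative sums *)

Lemma esumZl (R : realType) (T : choiceType) (D : set T) (q : R)
    (a : T -> \bar R) : 0 <= q -> (forall x, (0 <= a x)%E) ->
  \esum_(x in D) (q%:E * a x)%E = (q%:E * \esum_(x in D) a x)%E.
Proof.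
(* Finite subsums give one inequality; for [q > 0] the other is the same one applied with factor
   [q^-1]. *)
have le (r : R) (b : T -> \bar R) : 0 <= r -> (forall x, (0 <= b x)%E) ->
    (\esum_(x in D) (r%:E * b x) <= r%:E * \esum_(x in D) b x)%E.
  move=> r0 b0; apply: ge_ereal_sup => _ [X [finX XD] <-].
  rewrite -ge0_mule_fsumr// lee_wpmul2l ?lee_fin//.
  by apply: esum_ge; exists X.
rewrite le_eqVlt => /predU1P[<- _|q0 a0].
  by rewrite mul0e esum1// => x _; rewrite mul0e.
apply/eqP; rewrite eq_le; apply/andP; split.
  by apply: le => //; exact: ltW.
rewrite -lee_pdivlMl//.
rewrite [X in (X <= _)%E](_ : _ = \esum_(x in D) (q^-1%:E * (q%:E * a x))%E).
  by apply: le => [|x]; rewrite ?invr_ge0 ?mule_ge0 ?lee_fin// ltW.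
by apply: eq_esum => x _; rewrite muleA -EFinM mulVf ?gt_eqF// mul1e.
Qed.

Lemma esum_two_profile (R : realType) (i : 'I_2) (a : profile 2 -> \bar R) :
  (forall P, (0 <= a P)%E) ->
  \esum_(P in [set: profile 2]) a P =
  \esum_(S in [set: strategy]) \esum_(T in [set: strategy])
    a (two_profile i S T).
Proof.
move=> a0; rewrite esum_esum//.
apply: (@reindex_esum R (strategy * strategy)%type (profile 2)
  ([set: strategy] `*`` (fun=> [set: strategy]%classic)) setT
  (fun ST => two_profile i ST.1 ST.2) a).
have ji : lift i ord0 != i by rewrite eq_sym neq_lift.
split=> //.
- move=> [S T] [S' T'] _ _ /= /ffunP E.
  have := E i; have := E (lift i ord0).
  by rewrite !ffunE eqxx (negbTE ji) => -> ->.
- by move=> P _; exists (P i, P (lift i ord0)) => //=; exact: two_profileE.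
Qed.

(** * Expected payoff expressed by expected loss *)

Section two_bidders.
Variables (R : realType) (v c : R).
Hypotheses (v0 : 0 < v) (c0 : 0 < c).

(* Measuring payoffs downwards from the upper bound [v] makes all sums below
   sums of nonnegative terms. *)
Definition loss (i : 'I_2) (S T : strategy) : R :=
  v - payoff v c (two_profile i S T) i.

Lemma loss_ge0 (i : 'I_2) (S T : strategy) : 0 <= loss i S T.
Proof.
rewrite /loss payoff2E; have := gross_le S T i (ltW v0).
have : 0 <= c * (#|` S|)%:R by rewrite mulr_ge0 ?ler0n ?(ltW c0).
set x := c * _; lra.
Qed.

Definition expected_loss (i : 'I_2) (tau : mixed_strategy R) (S : strategy) :=
  \esum_(T in [set: strategy]) (tau T * loss i S T)%:E.

Lemma expected_loss_ge0 (i : 'I_2) (tau : mixed_strategy R) (S : strategy) :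
  (0 <= expected_loss i tau S)%E.
Proof.
by apply: esum_ge0 => T _; rewrite lee_fin mulr_ge0 ?prob_ge0 ?loss_ge0.
Qed.

Lemma prob_two_profile (sigma : 'I_2 -> mixed_strategy R) (i : 'I_2)
    (S T : strategy) :
  \prod_(k < 2) sigma k (two_profile i S T k) =
  sigma i S * sigma (lift i ord0) T.
Proof.
rewrite (bigD1_ord i)//= big_ord_recl big_ord0 mulr1 !ffunE eqxx.
by rewrite eq_sym (negbTE (neq_lift _ _)).
Qed.

Lemma expected_payoffE (sigma : 'I_2 -> mixed_strategy R) (i : 'I_2) :
  expected_payoff v c sigma i =
  (v%:E - \esum_(S in [set: strategy])
     ((sigma i S)%:E * expected_loss i (sigma (lift i ord0)) S))%E.
Proof.
rewrite /expected_payoff.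
set w := fun P : profile 2 => \prod_(j < 2) sigma j (P j).
set f := fun P : profile 2 => _.
have w0 P : 0 <= w P by apply: prodr_ge0 => k _; exact: prob_ge0.
have sum_w (r : R) : 0 <= r ->
    \esum_(P in [set: profile 2]) (w P * r)%:E = r%:E.
  move=> r0; rewrite (esum_two_profile i) => [|P]; last first.
    by rewrite lee_fin mulr_ge0.
  under eq_esum => S _.
    under eq_esum => T _.
      rewrite /w prob_two_profile mulrAC EFinM.
      over.
    rewrite esumZl ?mulr_ge0 ?prob_ge0//; last first.
      by move=> T; rewrite lee_fin prob_ge0.
    rewrite prob_sum1 mule1 mulrC EFinM.
    over.
  rewrite esumZl ?prob_sum1 ?mule1// => T.
  by rewrite lee_fin prob_ge0.
have u_le P : payoff v c P i <= v.
  by rewrite -(two_profileE i P) -subr_ge0; exact: loss_ge0.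
set A := esum _ f^\+%E; set N := esum _ f^\-%E.
set B := \esum_(S in _) _.
have BE : B = \esum_(P in [set: profile 2]) (w P * (v - payoff v c P i))%:E.
  rewrite (esum_two_profile i) => [|P]; last first.
    by rewrite lee_fin mulr_ge0// subr_ge0.
  apply: eq_esum => S _; rewrite -esumZl ?prob_ge0//; last first.
    by move=> T; rewrite lee_fin mulr_ge0 ?prob_ge0 ?loss_ge0.
  apply: eq_esum => T _.
  by rewrite /w prob_two_profile -mulrA -EFinM.
have wv0 P : (0 <= (w P * v)%:E)%E by rewrite lee_fin mulr_ge0 ?(ltW v0).
have wl0 P : (0 <= (w P * (v - payoff v c P i))%:E)%E.
  by rewrite lee_fin mulr_ge0// subr_ge0.
(* Both [B] and [N] may be infinite, so the identity is stated with additions only; [A] is at most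
   [v] and can be subtracted afterwards. *)
have balance : (B + A = v%:E + N)%E.
  rewrite BE -(sum_w v (ltW v0)) -!esumD//.
  apply: eq_esum => P _; rewrite funeposE funenegE /f -EFinN -!EFin_max -!EFinD.
  congr EFin; rewrite -/(w P) mulrBr.
  by rewrite !maxEle oppr_le0; case: (leP 0 (_ * payoff _ _ _ _));
    case: (leP (_ * payoff _ _ _ _) 0); lra.
have A_fin : A \is a fin_num.
  rewrite ge0_fin_numE; last exact: esum_ge0.
  apply: le_lt_trans (ltry v); rewrite -(sum_w v (ltW v0)).
  apply: le_esum => P _; rewrite funeposE /f -EFin_max lee_fin ge_max.
  apply/andP; split; first exact: (ler_wpM2l (w0 P) (u_le P)).
  by rewrite mulr_ge0 ?(ltW v0).
have N0 : (0 <= N)%E by exact: esum_ge0.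
have {balance}-> : B = (v%:E + N - A)%E by rewrite -balance addeK.
move: A_fin N0; case: A => // a _; case: N => [b| |]//= _.
by congr EFin; ring.
Qed.

(** * Deviations that move probability mass *)

(** This plays [M] whenever [sigma] would play [S]. Written as two summands, it gives back [sigma]
    when [M] is [S], which yields [esum_split]. *)
Definition transfer (sigma : mixed_strategy R) (S M : strategy) :
    strategy -> R :=
  fun T => (if T == S then 0 else sigma T) + (if T == M then sigma S else 0).

Lemma transfer_ge0 (sigma : mixed_strategy R) (S M T : strategy) :
  0 <= transfer sigma S M T.
Proof. by rewrite addr_ge0//; case: ifP => // _; exact: prob_ge0. Qed.

Section transfer_sums.
Variables (sigma : mixed_strategy R) (S : strategy) (a : strategy -> \bar R).
Hypothesis a0 : forall T, (0 <= a T)%E.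

Let rest :=
  \esum_(T in [set: strategy]) ((if T == S then 0 else sigma T)%:E * a T)%E.

Lemma esum_point (q : R) (M : strategy) : 0 <= q ->
  \esum_(T in [set: strategy]) ((if T == M then q else 0)%:E * a T)%E =
  (q%:E * a M)%E.
Proof.
move=> q0; rewrite -(@esum_set1 _ _ M (fun T => q%:E * a T)%E); last first.
  by rewrite mule_ge0 ?lee_fin.
rewrite [RHS]esum_mkcond; apply: eq_esum => T _.
case: eqVneq => [->|TM]; first by rewrite mem_set.
by rewrite memNset ?mul0e// => /eqP; rewrite (negbTE TM).
Qed.

Lemma esum_transfer (M : strategy) :
  \esum_(T in [set: strategy]) ((transfer sigma S M T)%:E * a T)%E =
  (rest + (sigma S)%:E * a M)%E.
Proof.
rewrite -esum_point ?prob_ge0// -esumD.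
- apply: eq_esum => T _; rewrite /transfer EFinD ge0_muleDl// lee_fin;
    by case: ifP => // _; exact: prob_ge0.
- by move=> T _; rewrite mule_ge0// lee_fin; case: ifP => // _; exact: prob_ge0.
- by move=> T _; rewrite mule_ge0// lee_fin; case: ifP => // _; exact: prob_ge0.
Qed.

Lemma esum_split :
  \esum_(T in [set: strategy]) ((sigma T)%:E * a T)%E =
  (rest + (sigma S)%:E * a S)%E.
Proof.
rewrite -esum_transfer; apply: eq_esum => T _; congr (_%:E * _)%E.
by rewrite /transfer; case: eqVneq => [->|_]; rewrite ?add0r ?addr0.
Qed.

End transfer_sums.

Lemma transfer_sum1 (sigma : mixed_strategy R) (S M : strategy) :
  \esum_(T in [set: strategy]) (transfer sigma S M T)%:E = 1%E.
Proof.
rewrite -(prob_sum1 sigma).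
have one_ge0 (T : strategy) : (0 <= 1 :> \bar R)%E by exact: lee01.
have mul1 (f : strategy -> R) : \esum_(T in [set: strategy]) (f T)%:E =
    \esum_(T in [set: strategy]) ((f T)%:E * 1)%E.
  by apply: eq_esum => T _; rewrite mule1.
rewrite (mul1 sigma) (mul1 (transfer _ _ _)) (esum_transfer sigma S one_ge0).
by rewrite -(esum_split _ _ one_ge0).
Qed.

Definition transfer_strategy (sigma : mixed_strategy R) (S M : strategy) :=
  MixedStrategy (transfer_ge0 sigma S M) (transfer_sum1 sigma S M).

Definition pure_prob (M T : strategy) : R := if T == M then 1 else 0.

Lemma pure_prob_ge0 (M T : strategy) : 0 <= pure_prob M T.
Proof. by rewrite /pure_prob; case: ifP. Qed.

Lemma pure_prob_sum1 (M : strategy) :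
  \esum_(T in [set: strategy]) (pure_prob M T)%:E = 1%E.
Proof.
have /= := esum_point (a := fun=> 1%E) (fun=> lee01) M ler01.
by under eq_esum do rewrite mule1; rewrite mule1.
Qed.

Definition pure_strategy (M : strategy) :=
  MixedStrategy (pure_prob_ge0 M) (pure_prob_sum1 M).

(** * Best responses in equilibrium *)

Section equilibrium.
Variables (sigma : 'I_2 -> mixed_strategy R) (i : 'I_2).
Hypothesis hsigma : nash_equilibrium v c sigma.

Let opponent := sigma (lift i ord0).
Let l := expected_loss i opponent.

Lemma nash_loss (tau : mixed_strategy R) :
  (\esum_(S in [set: strategy]) ((sigma i S)%:E * l S) <=
   \esum_(S in [set: strategy]) ((tau S)%:E * l S))%E.
Proof.
have := hsigma i tau; rewrite !expected_payoffE /= eqxx.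
by rewrite eq_sym (negbTE (neq_lift _ _)) leeD2lE// leeN2.
Qed.

(** Staying out is a deviation with payoff 0, that is, with loss exactly [v]. *)
Lemma nash_loss_fin :
  (\esum_(S in [set: strategy]) ((sigma i S)%:E * l S) < +oo)%E.
Proof.
apply: le_lt_trans (nash_loss (pure_strategy fset0)) _.
rewrite /= esum_point => [|T|]; rewrite ?expected_loss_ge0// mul1e.
rewrite /l /expected_loss [ltLHS](_ : _ = v%:E) ?ltry//.
rewrite -[RHS]mule1 -(prob_sum1 opponent) -esumZl ?(ltW v0)//; last first.
  by move=> T; rewrite lee_fin prob_ge0.
apply: eq_esum => T _; rewrite /loss payoff2E gross_subset//.
by rewrite cardfs0 mulr0 !subr0 mulrC EFinM.
Qed.

(** Moving the mass of [S] to [M] changes a single term of the expected loss. The common [rest] is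
    finite and cancels, as does the positive factor [sigma i S]. An infinite [l S] would make the
    equilibrium loss infinite. *)
Lemma support_best_response (S M : strategy) : 0 < sigma i S ->
  (l S < +oo /\ l S <= l M)%E.
Proof.
move=> S0; have l0 T : (0 <= l T)%E by exact: expected_loss_ge0.
have fin := nash_loss_fin; have := nash_loss (transfer_strategy (sigma i) S M).
rewrite (esum_split _ S l0) in fin *.
rewrite /= esum_transfer//; set rest := esum _ _ in fin *.
have rest0 : (0 <= rest)%E.
  apply: esum_ge0 => T _; rewrite mule_ge0// lee_fin.
  by case: ifP => // _; exact: prob_ge0.
have rest_fin : rest \is a fin_num.
  rewrite ge0_fin_numE//; apply: le_lt_trans fin.
  by rewrite leeDl// mule_ge0// lee_fin ltW.
rewrite leeD2lE// lee_pmul2l// => lSM; split=> //.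
move: fin; rewrite !ltey; apply: contra => /eqP->.
by rewrite gt0_muley ?lte_fin// addey// -ltNye (lt_le_trans (ltNyr 0)).
Qed.

End equilibrium.
End two_bidders.

Theorem theorem3p1 (R : realType) (v c : R) (hv : 0 < v) (hc : 0 < c)
    (sigma : 'I_2 -> mixed_strategy R) (hsigma : nash_equilibrium v c sigma) :
  forall i : 'I_2, monotone_strategy (sigma i).
Proof.
move=> i S S0; apply: contrapT => /first_gap_exists[m [a [below mS aS ma]]].
have [x [y [e [M [N [x0 y0 e0 dom]]]]]] := gap_dominated below mS aS ma i hv hc.
set tau := sigma (lift i ord0).
have [lS_fin lSM] := support_best_response hv hc hsigma M S0.
have [_ lSN] := support_best_response hv hc hsigma N S0.
rewrite -/tau in lS_fin lSM lSN.
have l0 := expected_loss_ge0 hv hc i tau.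
have w0 U T : (0 <= (tau T * loss v c i U T)%:E)%E.
  by rewrite lee_fin mulr_ge0 ?prob_ge0 ?loss_ge0.
(* Dominance, reversed by passing to losses, is averaged over [tau]; the margin stays [e] because
   [tau] has total mass 1. *)
have: (x%:E * expected_loss v c i tau M +
    y%:E * expected_loss v c i tau N + e%:E <=
    (x + y)%:E * expected_loss v c i tau S)%E.
  rewrite -[e%:E]mule1 -(prob_sum1 tau) -!esumZl ?addr_ge0 ?(ltW e0)//;
    last first.
    by move=> T; rewrite lee_fin prob_ge0.
  rewrite -!esumD; try by move=> T _;
    rewrite ?adde_ge0 ?mule_ge0 ?lee_fin ?mulr_ge0 ?prob_ge0 ?loss_ge0 ?(ltW e0).
  apply: le_esum => T _; rewrite -!EFinM -!EFinD lee_fin.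
  rewrite !(mulrCA _ (tau T)) (mulrC e) -!mulrDr ler_wpM2l ?prob_ge0//.
  by have := dom T; rewrite /loss; lra.
(* Optimality of [S] against both [M] and [N] gives the opposite strict inequality, since [e > 0]
   and the loss of [S] is finite. *)
apply/negP; rewrite -ltNge.
have /fineK lSE : expected_loss v c i tau S \is a fin_num.
  by rewrite ge0_fin_numE.
apply: lt_le_trans
  (leeD (leeD (lee_wpmul2l _ lSM) (lee_wpmul2l _ lSN)) (lexx _)).
- by rewrite -lSE -!EFinM -!EFinD lte_fin; lra.
- by rewrite lee_fin.
- by rewrite lee_fin.
Qed.
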